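(* For each positive integer $n$ let $R_n$ denote the complement of the disjoint union $P_{n-1}\cup\{n\}$ of a path on $n-1$ vertices and an isolated vertex. Then for $n\ge 2$, $$q(R_n)=\begin{cases}2, & n=2 \text{ or } n\ge 6,\\ 3, & 3\le n\le 5.\end{cases}$$ In particular, for all positive integers $n$, the graphs $G=R_n$ and $G=R_n^c$ satisfy the inequality $q(G)+q(G^c)\le |G|+2$.
   Context: All graphs are finite, undirected and simple; $|G|$ is the number of vertices of $G$, and $G^c$ is the complement of $G$. For a graph $G$ with vertex set $\{1,\dots,n\}$, $S(G)$ is the set of all real symmetric $n\times n$ matrices $A=(a_{ij})$ such that for $i\ne j$, $a_{ij}\neq 0$ if and only if $\{i,j\}$ is an edge of $G$ (no restriction on the diagonal). $q(A)$ is the number of distinct eigenvalues of $A$, and $q(G)=\min\{q(A): A\in S(G)\}$. $P_n$ is the path on $n$ vertices ($P_0$ is the graph with no vertices, so $R_1$ is a single vertex). *)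

(* Defs.v *)
From HB Require Import structures.
From mathcomp Require Import all_boot all_order all_algebra.
From mathcomp Require Import finmap.
From mathcomp Require Import boolp classical_sets functions cardinality reals.

Set Implicit Arguments.
Unset Strict Implicit.
Unset Printing Implicit Defensive.

Import Order.TTheory GRing.Theory Num.Theory.
Local Open Scope classical_set_scope.
Local Open Scope ring_scope.

(* Vertices are numbered from 0, i.e. they are the elements of 'I_n. *)
Record sgraph (n : nat) := SGraph {
  adj :> rel 'I_n;
  adj_sym : symmetric adj;
  adj_irr : irreflexive adj }.

Definition gorder (n : nat) (G : sgraph n) : nat := n.

Definition compl_rel (n : nat) (G : sgraph n) : rel 'I_n :=
  [rel i j : 'I_n | (i != j) && ~~ G i j].

Fact compl_sym (n : nat) (G : sgraph n) : symmetric (compl_rel G).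
Proof. by move=> i j; rewrite /compl_rel /= eq_sym adj_sym. Qed.

Fact compl_irr (n : nat) (G : sgraph n) : irreflexive (compl_rel G).
Proof. by move=> i; rewrite /compl_rel /= eqxx. Qed.

Definition compl (n : nat) (G : sgraph n) : sgraph n :=
  SGraph (@compl_sym n G) (@compl_irr n G).

Definition path_rel (n : nat) : rel 'I_n :=
  [rel i j : 'I_n | (i.+1 == j :> nat) || (j.+1 == i :> nat)].

Fact path_sym (n : nat) : symmetric (@path_rel n).
Proof. by move=> i j; rewrite /path_rel /= orbC. Qed.

Fact path_irr (n : nat) : irreflexive (@path_rel n).
Proof. by move=> i; rewrite /path_rel /= orbb eqn_leq ltnn. Qed.

Definition path_graph (n : nat) : sgraph n :=
  SGraph (@path_sym n) (@path_irr n).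

Definition empty_rel (n : nat) : rel 'I_n := [rel i j | false].

Fact empty_sym (n : nat) : symmetric (@empty_rel n).
Proof. by []. Qed.

Fact empty_irr (n : nat) : irreflexive (@empty_rel n).
Proof. by []. Qed.

Definition edgeless (n : nat) : sgraph n :=
  SGraph (@empty_sym n) (@empty_irr n).

Definition dunion_rel (m n : nat) (G : sgraph m) (H : sgraph n) :
    rel 'I_(m + n) :=
  fun i j => match fintype.split i, fintype.split j with
             | inl i', inl j' => G i' j'
             | inr i', inr j' => H i' j'
             | _, _ => false
             end.

Fact dunion_sym (m n : nat) (G : sgraph m) (H : sgraph n) :
  symmetric (dunion_rel G H).
Proof.
by move=> i j; rewrite /dunion_rel; case: fintype.split => i'; case: fintype.split => j' //;
  rewrite adj_sym.
Qed.

Fact dunion_irr (m n : nat) (G : sgraph m) (H : sgraph n) :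
  irreflexive (dunion_rel G H).
Proof. by move=> i; rewrite /dunion_rel; case: fintype.split => i'; rewrite adj_irr. Qed.

Definition dunion (m n : nat) (G : sgraph m) (H : sgraph n) : sgraph (m + n) :=
  SGraph (@dunion_sym m n G H) (@dunion_irr m n G H).

(* Meaningful for 0 < n only; then n.-1 + 1 = n. *)
Definition Rgraph (n : nat) : sgraph (n.-1 + 1) :=
  compl (dunion (path_graph n.-1) (edgeless 1)).

Section DistinctEigenvalues.
Variable R : realType.

Definition SG (n : nat) (G : sgraph n) : set 'M[R]_n :=
  [set A | A^T = A /\ forall i j, i != j -> (A i j != 0 <-> G i j)].

Definition spectrum (n : nat) (A : 'M[R]_n) : set R :=
  [set a | eigenvalue A a].

(* fset_set is the intended finite set only on finite arguments (it is empty
   on infinite ones); by finite_spectrum this case does not occur. *)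
Definition q_mx (n : nat) (A : 'M[R]_n) : nat := #|` fset_set (spectrum A)|.

Fact finite_spectrum (n : nat) (A : 'M[R]_n) : finite_set (spectrum A).
Proof.
apply: contrapT => /(infinite_set_fset n.+1)[B BA].
rewrite leqNgt -(size_char_poly A) max_poly_roots ?fset_uniq//.
  by rewrite monic_neq0 ?char_poly_monic.
by apply/allP => a /BA; rewrite /spectrum/= eigenvalue_root_char.
Qed.

Fact SG_nonempty (n : nat) (G : sgraph n) : SG G !=set0.
Proof.
exists (\matrix_(i, j) (G i j)%:R); split.
  by apply/matrixP => i j; rewrite !mxE adj_sym.
by move=> i j _; rewrite mxE; case: (G i j); rewrite ?oner_neq0 ?eqxx.
Qed.

Fact q_attained (n : nat) (G : sgraph n) :
  exists k : nat, `[< exists2 A, SG G A & q_mx A = k >].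
Proof. by have [A GA] := SG_nonempty G; exists (q_mx A); apply/asboolP; exists A. Qed.

Definition q (n : nat) (G : sgraph n) : nat := ex_minn (q_attained G).

End DistinctEigenvalues.

(* Main.v *)
Require Import Defs.
From mathcomp Require Import all_boot all_order all_algebra.
From mathcomp Require Import spectral complex ring lra zify.
From mathcomp Require Import finmap boolp classical_sets cardinality reals.

Set Implicit Arguments.
Unset Strict Implicit.
Unset Printing Implicit Defensive.

Import Order.TTheory GRing.Theory Num.Theory.

(** R_n is the join of one vertex, the apex, with the complement of the path
    on m = n - 1 vertices.  Hence two path vertices are non-adjacent in R_n
    exactly when they are consecutive on the path.

    Lower bounds.  A real symmetric matrix A is diagonalizable, so if it has
    at most two eigenvalues a and b then (A - a)(A - b) = 0
    ([sym_quadratic]).  With a = b this forces A to be scalar, which an edge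
    forbids ([q_ge2]).  In general the (i, j) entry of the identity shows that
    two non-adjacent vertices i and j cannot have exactly one common neighbour
    k, since (A ^ 2)_ij would be the single nonzero product A_ik A_kj
    ([q_ge3]).  For n = 3, 4, 5 some consecutive pair of the path has the apex
    as its only common neighbour.

    Upper bound 2 for n >= 6.  Suppose that vectors v_i of R^3, one for each
    vertex, satisfy v_i . v_j = 0 exactly for the non-adjacent pairs, and that
    the identity matrix is the combination of the matrices v_i^T v_i with some
    positive weights c_i (a tight frame).  The rows sqrt(c_i) v_i form a matrix
    V with V^T V = 1, so A = V V^T is idempotent with the pattern of R_n, and
    its eigenvalues lie in {0, 1} ([q_le2_of_tight]).  Such a frame with
    six vectors is explicit ([fan6]).  It is prolonged one path vertex at a
    time: the new vector is orthogonal to the last one and avoids the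
    hyperplanes orthogonal to the others ([fan_pattern_extend]).  It receives
    a small weight, which the earlier weights can absorb because the matrices
    v_i^T v_i already span all symmetric matrices ([tight_extend]).

    Upper bound 3 for n = 4, 5 comes from explicit integer matrices annihilated
    by a cubic.  Finally, the complement of R_n is a path plus an isolated
    vertex.  The Laplacian of the path, bordered by zero, shows that its q is
    at most n - 1 ([q_dunion_point]): the isolated vertex reuses the eigenvalue
    0 of the Laplacian. *)

(** * Bounding q by annihilating polynomials *)

Section Eigenvalues.
Local Open Scope ring_scope.
Variable R : realType.

Lemma q_mx_le_size n (A : 'M[R]_n) (s : seq R) :
  (forall a, eigenvalue A a -> a \in s) -> (q_mx A <= size s)%N.
Proof.
move=> sA; apply: uniq_leq_size; first exact: fset_uniq.
by move=> a; rewrite in_fset_set ?inE; [exact: sA|exact: finite_spectrum].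
Qed.

Lemma q_mxP n (A : 'M[R]_n) :
  {s : seq R | size s = q_mx A & forall a, eigenvalue A a -> a \in s}.
Proof.
exists (fset_set (spectrum A)) => // a Aa.
by rewrite in_fset_set ?inE//; exact: finite_spectrum.
Qed.

Lemma q_mx_le_poly n (A : 'M[R]_n) (p : {poly R}) : p != 0 ->
  (forall a, eigenvalue A a -> root p a) -> (q_mx A <= (size p).-1)%N.
Proof.
move=> p0 rp; rewrite -ltnS prednK ?size_poly_gt0//.
apply: max_poly_roots => //; last exact: fset_uniq.
apply/allP => a; rewrite in_fset_set ?inE; last exact: finite_spectrum.
exact: rp.
Qed.

Lemma q_mx_le_dim n (A : 'M[R]_n) : (q_mx A <= n)%N.
Proof.
rewrite -[n in (_ <= n)%N]/(n.+1.-1) -(size_char_poly A); apply: q_mx_le_poly.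
  by rewrite monic_neq0 ?char_poly_monic.
by move=> a; rewrite eigenvalue_root_char.
Qed.

Lemma q_le n (G : sgraph n) (A : 'M[R]_n) k :
  SG G A -> (q_mx A <= k)%N -> (q R G <= k)%N.
Proof.
rewrite /q => GA; apply: leq_trans; case: ex_minnP => m _; apply.
by apply/asboolP; exists A.
Qed.

Lemma q_ge n (G : sgraph n) k :
  (forall A : 'M[R]_n, SG G A -> (k <= q_mx A)%N) -> (k <= q R G)%N.
Proof.
by rewrite /q => kA; case: ex_minnP => m /asboolP[A GA <-] _; exact: kA.
Qed.

Lemma q_le_order n (G : sgraph n) : (q R G <= n)%N.
Proof. by have [A GA] := SG_nonempty R G; apply: q_le GA (q_mx_le_dim A). Qed.

Lemma eq_q n (G H : sgraph n) : G =2 H -> q R G = q R H.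
Proof.
move=> GH; apply/eqP; rewrite eqn_leq; apply/andP; split; apply: q_ge => A [As GA];
  apply: q_le (leqnn _); split => // i j /GA ->; by rewrite GH.
Qed.

(** Every eigenvalue is a root of the monic cubic that annihilates A. *)
Lemma q_mx_le3 n (A : 'M[R]_n) a b c :
  A *m A *m A = a *: (A *m A) + b *: A + c%:M -> (q_mx A <= 3)%N.
Proof.
move=> AE; pose p := Poly [:: - c; - b; - a; 1].
apply: (@leq_trans (size p).-1); last first.
  by rewrite -subn1 leq_subLR; apply: size_Poly.
apply: q_mx_le_poly.
  apply/eqP => /polyP/(_ 3); rewrite coef_Poly coef0 /= => /eqP.
  by rewrite oner_eq0.
move=> x /eigenvalueP[v vA v0].
have : (x ^+ 3 - a * x ^+ 2 - b * x - c) *: v = 0.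
  have := congr1 (mulmx v) AE.
  rewrite !mulmxDr -!scalemxAr mul_mx_scalar !mulmxA !(vA, =^~ scalemxAl).
  rewrite !scalerA -!scalerDl => E.
  rewrite (_ : _ - c = x * x * x - (a * (x * x) + b * x + c)); last by ring.
  by rewrite scalerBl E subrr.
move/eqP; rewrite scaler_eq0 (negPf v0) orbF => /eqP E.
by apply/eqP; rewrite horner_Poly /=; rewrite -[RHS]E; ring.
Qed.

Lemma q_mx_idem n (A : 'M[R]_n) : A *m A = A -> (q_mx A <= 2)%N.
Proof.
move=> AE; apply: (@q_mx_le_size _ _ [:: 0; 1]) => x /eigenvalueP[v vA v0].
have := congr1 (mulmx v) AE; rewrite mulmxA vA -scalemxAl vA => /eqP.
rewrite -subr_eq0 -scalerBr scaler_eq0 !inE => /orP[->//|].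
by rewrite -{2}[v]scale1r -scalerBl scaler_eq0 (negPf v0) orbF subr_eq0 => ->; rewrite orbT.
Qed.

End Eigenvalues.

(** * Lower bounds from the spectral theorem *)

Section LowerBounds.
Local Open Scope ring_scope.
Variable R : realType.

(** Over the complex numbers A is unitarily similar to a diagonal matrix with
    real entries.  These entries are eigenvalues of A over R, because the
    characteristic polynomial is the same, so each of them is a or b and the
    diagonal matrix satisfies the quadratic equation with roots a and b. *)
Lemma sym_quadratic n (A : 'M[R]_n) (a b : R) : A^T = A ->
  (forall x, eigenvalue A x -> x \in [:: a; b]) ->
  A *m A = (a + b) *: A - (a * b)%:M.
Proof.
move=> As Aev.
pose toC : {rmorphism R -> R[i]} := real_complex R.
set B := map_mx toC A.
have Bherm : B \is hermsymmx.
  apply: realsym_hermsym.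
    apply/is_hermitianmxP; rewrite expr0 scale1r.
    by rewrite map_mx_id // /B map_trmx As.
  by apply/mxOverP => i j; rewrite mxE; apply/complex_realP; exists (A i j).
have /orthomx_spectralP Bdiag := hermitian_normalmx Bherm.
set P := spectralmx B in Bdiag; set d := spectral_diag B in Bdiag.
have Pu : P \in unitmx by exact: spectral_unit.
(* The rows of P are eigenvectors of B. *)
have dab i : (d 0 i - toC a) * (d 0 i - toC b) = 0.
  have /mxOverP/(_ 0 i)/complex_realP[x dE] := hermitian_spectral_diag_real Bherm.
  rewrite -/d -[_%:C%C]/(toC x) in dE.
  have : eigenvalue B (d 0 i).
    apply/eigenvalueP; exists (row i P).
      rewrite {1}Bdiag rowE -!mulmxA mulKVmx// mulmxA.
      by rewrite -[delta_mx 0 i *m diag_mx d]rowE row_diag_mx -scalemxAl.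
    apply: contraTN Pu => /eqP Pi0; apply/negP => Pu.
    have /matrixP/(_ 0 i) : row i (P *m invmx P) = 0.
      by rewrite row_mul Pi0 mul0mx.
    by rewrite mulmxV// !mxE eqxx => /eqP; rewrite oner_eq0.
  rewrite eigenvalue_root_char -map_char_poly dE fmorph_root.
  rewrite -eigenvalue_root_char => /Aev; rewrite !inE.
  by case/orP => /eqP ->; rewrite subrr ?mul0r ?mulr0.
apply: (@map_mx_inj _ _ toC).
rewrite map_mxM map_mxD map_mxZ map_mxN map_scalar_mx -/B.
have -> : B *m B = invmx P *m (diag_mx d *m diag_mx d) *m P.
  by rewrite {1 2}Bdiag !mulmxA mulmxK.
have -> : (toC (a * b))%:M = invmx P *m (toC (a * b))%:M *m P.
  by rewrite mul_mx_scalar -scalemxAl mulVmx// scalemx1.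
rewrite {1}Bdiag scalemxAl scalemxAr -mulmxBl -mulmxBr; congr (_ *m _ *m _).
apply/matrixP => i j; rewrite mulmx_diag !mxE.
have [->|] := eqVneq i j; last by rewrite !mulr0n mulr0 subr0.
rewrite !mulr1n rmorphD rmorphM; apply/eqP; rewrite -subr_eq0.
by apply/eqP; rewrite -[RHS](dab j); ring.
Qed.

(** With a single eigenvalue a, the i-th diagonal entry of (A - a) ^ 2 = 0 is
    a sum of squares, one of which is that of A i j. *)
Lemma q_ge2 n (G : sgraph n) i j : G i j -> (2 <= q R G)%N.
Proof.
move=> Gij; apply: q_ge => A [As GA]; rewrite leqNgt; apply/negP => qA.
have ij : i != j by apply: contraTneq Gij => ->; rewrite adj_irr.
(* If s is empty, the default value of head is harmless: the claim is only an
   inclusion. *)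
have [s sA evA] := q_mxP A.
have sub x : eigenvalue A x -> x \in [:: head 0 s; head 0 s].
  move/evA; move: qA; rewrite -sA; case: (s) => [|y [|//]] //= _.
  by rewrite !inE orbb.
have /matrixP/(_ i i) := sym_quadratic As sub; rewrite !mxE eqxx mulr1n.
set a := head 0 s; have Asym k : A k i = A i k by rewrite -{1}As mxE.
rewrite (bigD1 i)//= (bigD1 j) 1?eq_sym//= Asym.
set r := \sum_(k < n | _) _ => E.
have r0 : 0 <= r by apply: sumr_ge0 => k _; rewrite Asym -expr2 sqr_ge0.
have /(GA i j ij) Aij := Gij.
have : 0 < A i j ^+ 2 by rewrite exprn_even_gt0.
have := sqr_ge0 (A i i - a); move: E; rewrite !expr2; nra.
Qed.

(** If A had only two eigenvalues, A ^ 2 would be a combination of A and 1,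
    hence vanish at (i, j); but its entry there is A i k * A k j. *)
Lemma q_ge3 n (G : sgraph n) i j k : i != j -> ~~ G i j ->
  (forall l, G i l && G l j = (l == k)) -> (3 <= q R G)%N.
Proof.
move=> ij Gij nbr; apply: q_ge => A [As GA]; rewrite leqNgt; apply/negP => qA.
have [s sA evA] := q_mxP A.
have sub x : eigenvalue A x -> x \in [:: s`_0; s`_1].
  move/evA; move: qA; rewrite -sA; case: (s) => [|y [|z [|//]]] //= _.
  by rewrite !inE => ->.
have Anz u v : u != v -> (A u v == 0) = ~~ G u v.
  move=> /GA uv; apply/idP/idP => [|/negP nG].
    by apply: contraTN => /uv.
  by apply/negPn; apply/negP => /uv.
have Aij : A i j = 0 by apply/eqP; rewrite Anz.
have /matrixP/(_ i j) := sym_quadratic As sub; rewrite !mxE Aij (negPf ij).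
rewrite mulr0n mulr0 subr0 => /eqP.
have /andP[Gik Gkj] : G i k && G k j by rewrite nbr.
rewrite (bigD1 k)//= big1 ?addr0 => [|l lk].
  rewrite mulf_eq0 !Anz ?Gik ?Gkj//.
    by apply: contraTneq Gkj => ->; rewrite adj_irr.
  by apply: contraTneq Gik => ->; rewrite adj_irr.
have [<-|il] := eqVneq i l; first by rewrite Aij mulr0.
have [->|lj] := eqVneq l j; first by rewrite Aij mul0r.
by apply/eqP; rewrite mulf_eq0 !Anz// -negb_and nbr.
Qed.

End LowerBounds.

(** * Tight frames with a prescribed orthogonality pattern *)

Section Frames.
Local Open Scope ring_scope.
Variables (R : realType) (d : nat).
Implicit Types (u w p : 'rV[R]_d) (v : nat -> 'rV[R]_d) (c : nat -> R).

Definition dot u w : R := \sum_k u 0 k * w 0 k.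

Lemma dotC u w : dot u w = dot w u.
Proof. by apply: eq_bigr => k _; rewrite mulrC. Qed.

Lemma dotDl u u' w : dot (u + u') w = dot u w + dot u' w.
Proof. by rewrite -big_split; apply: eq_bigr => k _; rewrite mxE mulrDl. Qed.

Lemma dotZl t u w : dot (t *: u) w = t * dot u w.
Proof. by rewrite /dot mulr_sumr; apply: eq_bigr => k _; rewrite mxE mulrA. Qed.

Lemma dotBl u u' w : dot (u - u') w = dot u w - dot u' w.
Proof. by rewrite -[- u']scaleN1r dotDl dotZl mulN1r. Qed.

Lemma dot0l w : dot 0 w = 0.
Proof. by rewrite -(scale0r 0) dotZl mul0r. Qed.

Lemma dot_eq0 u : dot u u = 0 -> u = 0.
Proof.
move=> /eqP; rewrite psumr_eq0 => [/allP u0|k _]; last by rewrite -expr2 sqr_ge0.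
apply/rowP => k; rewrite mxE; apply/eqP.
by have := u0 k (mem_index_enum _); rewrite mulf_eq0 orbb.
Qed.

(** A vector space over an infinite field is not a finite union of proper
    subspaces, here for the hyperplane orthogonal to p.  A vector w good for
    the first k constraints and a vector w' good for the last one combine into
    w + t w': each constraint excludes at most one t, and t is chosen above all
    the excluded values. *)
Lemma avoid_hyperplanes p k (x : nat -> 'rV[R]_d) :
  (forall j, (j < k)%N -> exists2 w, dot w p = 0 & dot w (x j) != 0) ->
  exists2 w, dot w p = 0 & forall j, (j < k)%N -> dot w (x j) != 0.
Proof.
elim: k => [|k IHk] xk; first by exists 0; rewrite ?dot0l.
have [w wp wx] := IHk (fun j jk => xk j (ltnW jk)).
have [w' w'p w'x] := xk k (ltnSn k).
pose t := 1 + \sum_(j < k.+1) `|dot w (x j) / dot w' (x j)|.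
exists (w + t *: w'); first by rewrite dotDl dotZl wp w'p mulr0 addr0.
move=> j jk; rewrite dotDl dotZl.
have [w'j|w'j] := eqVneq (dot w' (x j)) 0.
  rewrite w'j mulr0 addr0 wx//; move: jk; rewrite ltnS leq_eqVlt => /orP[/eqP jk|//].
  by rewrite -jk w'j eqxx in w'x.
suff : dot w (x j) / dot w' (x j) + t != 0.
  by apply: contraNneq => E; rewrite -(mulfK w'j t) -mulrDl E mul0r.
rewrite gt_eqF// /t (bigD1 (Ordinal jk))//=.
set r := dot w _ / _; have := ler_norm (- r); rewrite normrN => nr.
have : 0 <= \sum_(i < k.+1 | i != Ordinal jk) `|dot w (x i) / dot w' (x i)|.
  exact: sumr_ge0.
lra.
Qed.

(** Index 0 is the apex, and the indices 1, ..., n - 1 follow the path. *)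
Definition fan_pattern n v := forall i j, (i < j < n)%N ->
  (dot (v i) (v j) == 0) = (0 < i)%N && (j == i.+1).

(** The frame operator of v with weights c. *)
Definition gram_sum n v c := \sum_(i < n) c i *: ((v i)^T *m v i).

Definition tight n v c :=
  (forall i, (i < n)%N -> 0 < c i) /\ gram_sum n v c = 1%:M.

(** By polarization, this says that the matrices v_i^T v_i with i < n span the
    symmetric matrices. *)
Definition gram_spanning n v := forall w, exists b, w^T *m w = gram_sum n v b.

Definition extend n (T : Type) (f : nat -> T) x i := if i == n then x else f i.

(** Each vector is non-orthogonal to the apex or, for the apex, to v 1. *)
Lemma fan_pattern_neq0 n v i : (1 < n)%N -> (i < n)%N -> fan_pattern n v -> v i != 0.
Proof.
move=> n1 ni pat; apply/eqP => vi0; case: i => [|i] in ni vi0.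
  by have := pat 0 1; rewrite n1 vi0 dot0l eqxx => /(_ erefl).
by have := pat 0 i.+1; rewrite ni vi0 dotC dot0l eqxx => /(_ erefl).
Qed.

(** The new vector must be orthogonal to the last vector b only.  By
    [avoid_hyperplanes] it suffices to find, for each earlier x, some vector
    orthogonal to b but not to x.  The predecessor of b does this for every x
    but its own predecessor a.  For x = a, the component of a orthogonal to b
    works, since a and b are not parallel: the predecessor of a is orthogonal
    to a and not to b.  The four last vectors must be path vectors,
    hence 5 <= n. *)
Lemma fan_pattern_extend n v : (5 <= n)%N -> fan_pattern n v ->
  exists w, fan_pattern n.+1 (extend n v w).
Proof.
case: n => [|[|[|[|[|n]]]]] // _ pat.
have nz i : (i < n.+4.+1)%N -> v i != 0 by move=> ni; apply: fan_pattern_neq0 pat.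
have dotP i j : (i < n.+4.+1)%N -> (j < n.+4.+1)%N ->
    (dot (v i) (v j) == 0) =
    [&& (0 < i)%N, (0 < j)%N & (j == i.+1) || (i == j.+1)].
  move=> ni nj; have [ij|ji|ij] := ltngtP i j.
  - by rewrite pat ?ij//; lia.
  - by rewrite dotC pat ?ji//; lia.
  - rewrite -ij (_ : _ && _ = false); [apply/eqP => /dot_eq0; exact/eqP/nz|lia].
have [j|w wp wx] := @avoid_hyperplanes (v n.+4) n.+4 v.
  move=> jn; have [->|jn2] := eqVneq j n.+2; last first.
    by exists (v n.+3); [apply/eqP|]; rewrite dotP; lia.
  set a := v n.+2; set b := v n.+4.
  exists (dot b b *: a - dot a b *: b).
    by rewrite dotBl !dotZl; ring.
  (* u lies in the span of a and b and is orthogonal to both. *)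
  set u := _ - _; apply/eqP => ua0.
  have u0 : u = 0.
    apply: dot_eq0; rewrite {1}/u dotBl !dotZl [dot a u]dotC ua0.
    by rewrite [dot b u]dotC /u dotBl !dotZl; ring.
  have : dot u (v n.+1) == 0 by rewrite u0 dot0l.
  rewrite dotBl !dotZl (eqP (_ : dot a _ == 0)) ?dotP; try lia.
  by rewrite mulr0 sub0r oppr_eq0 mulf_eq0 !dotP; lia.
exists w => i j; rewrite ltnS /extend => /andP[ij].
rewrite leq_eqVlt => /orP[/eqP jn|jn].
  rewrite jn eqxx ltn_eqF -?jn// dotC.
  have [in4|in4] := eqVneq i n.+4; first by rewrite in4 wp eqxx; lia.
  by rewrite (negPf (wx _ _)); lia.
by rewrite (ltn_eqF jn) (ltn_eqF (ltn_trans ij jn)) pat ?ij.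
Qed.

Lemma gram_sum_extend n v c w t :
  gram_sum n.+1 (extend n v w) (extend n c t) = gram_sum n v c + t *: (w^T *m w).
Proof.
rewrite /gram_sum big_ord_recr /= /extend eqxx; congr (_ + _).
by apply: eq_bigr => i _; rewrite ltn_eqF.
Qed.

Lemma gram_spanning_extend n v w :
  gram_spanning n v -> gram_spanning n.+1 (extend n v w).
Proof.
move=> span u; have [b ->] := span u; exists (extend n b 0).
by rewrite gram_sum_extend scale0r addr0.
Qed.

(** Writing w^T w as the combination of the v_i^T v_i with coefficients b_i, the
    frame operator is unchanged if w gets the weight e and each c_i is replaced
    by c_i - e b_i.  These stay positive for small e. *)
Lemma tight_extend n v c w : gram_spanning n v -> tight n v c ->
  exists c', tight n.+1 (extend n v w) c'.
Proof.
move=> span [c0 c1]; have [b wb] := span w.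
pose s := 1 + \sum_(i < n) `|b i / c i|.
(* 1 / s is below every c_i / b_i with b_i > 0. *)
have s0 : 0 < s by rewrite ltr_pwDl// sumr_ge0.
exists (extend n (fun i => c i - s^-1 * b i) s^-1); split=> [i|].
  rewrite ltnS leq_eqVlt /extend => /orP[/eqP ->|ni]; first by rewrite eqxx invr_gt0.
  rewrite ltn_eqF// subr_gt0 ltr_pdivrMl// -ltr_pdivrMr ?c0// /s (bigD1 (Ordinal ni))//=.
  have := ler_norm (b i / c i).
  have : 0 <= \sum_(k < n | k != Ordinal ni) `|b k / c k| by exact: sumr_ge0.
  lra.
rewrite gram_sum_extend wb -c1 /gram_sum scaler_sumr -big_split /=.
by apply: eq_bigr => i _; rewrite scalerA -scalerDl subrK.
Qed.

Lemma tight_fan m n v c : (5 <= m <= n)%N ->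
    fan_pattern m v -> tight m v c -> gram_spanning m v ->
  exists v', fan_pattern n v' /\ exists c', tight n v' c'.
Proof.
move=> /andP[m5 mn] pat vc span; suff : exists v', [/\ fan_pattern n v',
  exists c', tight n v' c' & gram_spanning n v'] by case=> v' [? ? _]; exists v'.
elim: n mn => [|n IHn]; first by lia.
rewrite leq_eqVlt => /orP[/eqP <-|]; first by exists v; split=> //; exists c.
rewrite ltnS => mn; have [v' [pat' [c' v'c'] span']] := IHn mn.
have [w patw] := fan_pattern_extend (leq_trans m5 mn) pat'.
exists (extend n v' w); split=> //; last exact: gram_spanning_extend.
exact: tight_extend v'c'.
Qed.

End Frames.

(** * The graphs R_n *)

Section Rn.
Variable R : realType.
Local Open Scope ring_scope.

Lemma path_pointE m (i j : 'I_(m + 1)) :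
  dunion (path_graph m) (edgeless 1) i j =
  [&& (i < m)%N, (j < m)%N & (i.+1 == j :> nat) || (j.+1 == i :> nat)].
Proof.
by rewrite /= /dunion_rel; case: splitP => i' ->; case: splitP => j' -> //=;
  rewrite ?ltn_ord // ltnNge leq_addr ?andbF.
Qed.

Lemma RgraphE m (i j : 'I_(m + 1)) : Rgraph m.+1 i j =
  (i != j) && ~~ [&& (i < m)%N, (j < m)%N & (i.+1 == j :> nat) || (j.+1 == i :> nat)].
Proof. by rewrite -path_pointE. Qed.

Lemma compl_complE n (G : sgraph n) : compl (compl G) =2 G.
Proof.
move=> i j; rewrite [LHS]/(_ && ~~ (_ && ~~ _)).
by have [->|ij] := eqVneq i j; [rewrite adj_irr|rewrite negbK].
Qed.

Lemma compl_RgraphE m : compl (Rgraph m.+1) =2 dunion (path_graph m) (edgeless 1).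
Proof. exact: compl_complE. Qed.

(** If V^T V = 1 then A = V V^T satisfies A A = A, and A i j is a positive
    multiple of the dot product of the vectors at i and j. *)
Lemma q_le2_of_tight d m (v : nat -> 'rV[R]_d) c :
  fan_pattern m.+1 v -> tight m.+1 v c -> (q R (Rgraph m.+1) <= 2)%N.
Proof.
move=> pat [c0 c1].
(* In R_n the apex is the last vertex; in a fan pattern it comes first. *)
pose s (i : 'I_(m + 1)) := if (i < m)%N then i.+1 else 0%N.
have sm i : (s i < m.+1)%N by rewrite /s; case: ifP.
pose V : 'M[R]_(m + 1, d) := \matrix_(i, k) (Num.sqrt (c (s i)) * v (s i) 0 k).
have VV : V^T *m V = 1%:M.
  have -> : V^T *m V = \sum_(i < m + 1) c (s i) *: ((v (s i))^T *m v (s i)).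
    apply/matrixP => k l; rewrite mxE summxE; apply: eq_bigr => i _.
    rewrite !mxE big_ord1 !mxE mulrACA -expr2 sqr_sqrtr//.
    exact: ltW (c0 _ (sm i)).
  rewrite -c1 /gram_sum big_split_ord big_ord1 big_ord_recl addrC /s /=.
  rewrite addn0 ltnn; congr (_ + _).
  by apply: eq_bigr => i _; rewrite ltn_ord.
have AE i j : (V *m V^T) i j =
    Num.sqrt (c (s i)) * Num.sqrt (c (s j)) * dot (v (s i)) (v (s j)).
  by rewrite mxE mulr_sumr; apply: eq_bigr => k _; rewrite !mxE mulrACA.
apply: (@q_le _ _ _ (V *m V^T)); last first.
  by apply: q_mx_idem; rewrite mulmxA -[V *m _ *m V]mulmxA VV mulmx1.
split; first by rewrite trmx_mul trmxK.
move=> i j ij.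
have -> : ((V *m V^T) i j != 0) = Rgraph m.+1 i j; last by [].
have sqrtc0 k : (Num.sqrt (c (s k)) == 0) = false.
  by rewrite gt_eqF// sqrtr_gt0 c0.
rewrite AE !mulf_eq0 !sqrtc0 !orFb RgraphE ij andTb.
congr (~~ _); move: ij; rewrite -val_eqE /=.
wlog ij : i j / (i < j)%N => [H|_].
  move=> ij; have [/H->//|ji|/eqP] := ltngtP i j; last by rewrite (negPf ij).
  by rewrite dotC H// 1?eq_sym// andbCA orbC.
have im : (i < m)%N by have := ltn_ord j; lia.
rewrite /s im; case: ifP => jm; last by rewrite dotC pat ?ltnS.
by rewrite pat ?ltnS ?ij//; lia.
Qed.

Definition vec (x y z : R) : 'rV[R]_3 := \row_k [:: x; y; z]`_k.

Lemma vecE (w : 'rV[R]_3) : w = vec (w 0 0) (w 0 1) (w 0 (inord 2)).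
Proof.
apply/rowP => -[[|[|[|//]]] k]; rewrite mxE /=; congr (w 0 _); apply: val_inj => //=.
by rewrite inordK.
Qed.

Lemma dot_vec x y z x' y' z' : dot (vec x y z) (vec x' y' z') = x * x' + y * y' + z * z'.
Proof. by rewrite /dot !big_ord_recl big_ord0 !mxE /= addr0 addrA. Qed.

(** In R^3 the symmetric matrices have dimension 6, so six vectors is the least
    number for [gram_spanning].  This choice makes the six matrices v_i^T v_i
    independent and puts the identity in the interior of their cone. *)
Definition fan6 : nat -> 'rV[R]_3 := nth 0
  [:: vec 2 0 1; vec 1 (-2) 0; vec 0 0 1; vec 1 0 0; vec 0 1 1; vec 1 1 (-1)].

Lemma fan6_pattern : fan_pattern 6 fan6.
Proof.
move=> i j /andP[].
case: j => [|[|[|[|[|[|j]]]]]] //; case: i => [|[|[|[|[|i]]]]] // _ _;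
  rewrite /fan6 /= dot_vec;
  by [apply: gt_eqF; lra | apply: lt_eqF; lra | apply: (introT eqP); lra].
Qed.

Lemma fan6_tight : tight 6 fan6 (nth 0 [:: 1/8; 1/8; 3/8; 1/8; 1/4; 1/4]).
Proof.
split=> [i i6|].
  by do 6 (case: i i6 => [_ /=|i i6]; first lra).
rewrite /gram_sum !big_ord_recl big_ord0 /fan6 /=.
apply/matrixP => -[[|[|[|//]]] k3] -[[|[|[|//]]] l3];
  rewrite !mxE !big_ord1 !mxE /=; lra.
Qed.

Lemma fan6_spanning : gram_spanning 6 fan6.
Proof.
move=> w; rewrite (vecE w); move: (w 0 0) (w 0 1) (w 0 (inord 2)) => x y z.
(* The coefficients invert the 6 x 6 linear system that expresses the monomials
   of degree 2 in x, y, z. *)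
exists (nth 0 [:: (y*y + 2*x*y + 4*x*z - y*z) / 8;
  (y*y - 2*x*y - y*z) / 8;
  (- 5*y*y + 8*z*z - 10*x*y - 4*x*z - 3*y*z) / 8;
  (8*x*x - 7*y*y - 10*x*y - 16*x*z + 7*y*z) / 8;
  (2*y*y + 4*x*y + 6*y*z) / 8;
  (2*y*y + 4*x*y - 2*y*z) / 8]).
rewrite /gram_sum !big_ord_recl big_ord0 /fan6 /=.
apply/matrixP => -[[|[|[|//]]] k3] -[[|[|[|//]]] l3];
  by rewrite !mxE !big_ord1 !mxE /=; field.
Qed.

Lemma q_Rgraph_le2 n : (6 <= n)%N -> (q R (Rgraph n) <= 2)%N.
Proof.
case: n => // m m6.
have [v [pat [c vc]]] :=
  tight_fan (m := 6) (n := m.+1) m6 fan6_pattern fan6_tight fan6_spanning.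
exact: q_le2_of_tight vc.
Qed.

Definition table n (rows : seq (seq R)) : 'M[R]_n := \matrix_(i, j) (nth [::] rows i)`_j.

Lemma q_Rgraph4_le3 : (q R (Rgraph 4) <= 3)%N.
Proof.
(* The Gram matrix of e1, e2, e1, e1 + e2 in the plane; its nonzero eigenvalues
   are the two roots of X ^ 2 - 5 X + 5. *)
pose A := @table (3 + 1)
  [:: [:: 1; 0; 1; 1]; [:: 0; 1; 0; 1]; [:: 1; 0; 1; 1]; [:: 1; 1; 1; 2]].
apply: (@q_le _ _ _ A).
  split.
    by apply/matrixP => -[[|[|[|[|//]]]] ?] [[|[|[|[|//]]]] ?]; rewrite !mxE.
  move=> i j ij; rewrite (RgraphE (m := 3)) ij /= !mxE; move: ij.
  by case: i => [[|[|[|[|//]]]] ?]; case: j => [[|[|[|[|//]]]] ?] //= _;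
    rewrite ?eqxx ?oner_eq0.
have A2 : A *m A = @table (3 + 1)
    [:: [:: 3; 1; 3; 4]; [:: 1; 2; 1; 3]; [:: 3; 1; 3; 4];
        [:: 4; 3; 4; 7]].
  apply/matrixP => -[[|[|[|[|//]]]] ?] [[|[|[|[|//]]]] ?];
    rewrite !mxE !big_ord_recl !big_ord0 !mxE /=; lra.
apply: (@q_mx_le3 _ _ _ 5 (-5) 0); rewrite A2.
apply/matrixP => -[[|[|[|[|//]]]] ?] [[|[|[|[|//]]]] ?];
  rewrite !mxE !big_ord_recl !big_ord0 !mxE /=; lra.
Qed.

Lemma q_Rgraph5_le3 : (q R (Rgraph 5) <= 3)%N.
Proof.
(* A is invariant under the reversal of the path.  On antisymmetric vectors it
   has eigenvalues 1 and -1, and its entries are chosen so that these recur on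
   symmetric vectors; the fifth eigenvalue is then 5. *)
pose A := @table (4 + 1) [:: [:: 2; 0; 1; 2; 1]; [:: 0; 0; 0; 1; 1];
  [:: 1; 0; 0; 0; 1]; [:: 2; 1; 0; 2; 1]; [:: 1; 1; 1; 1; 1]].
apply: (@q_le _ _ _ A).
  split.
    by apply/matrixP => -[[|[|[|[|[|//]]]]] ?] [[|[|[|[|[|//]]]]] ?]; rewrite !mxE.
  move=> i j ij; rewrite (RgraphE (m := 4)) ij /= !mxE; move: ij.
  by case: i => [[|[|[|[|[|//]]]]] ?]; case: j => [[|[|[|[|[|//]]]]] ?] //= _;
    rewrite ?eqxx ?oner_eq0 ?pnatr_eq0.
have A2 : A *m A = @table (4 + 1)
    [:: [:: 10; 3; 3; 9; 6]; [:: 3; 2; 1; 3; 2]; [:: 3; 1; 2; 3; 2];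
        [:: 9; 3; 3; 10; 6]; [:: 6; 2; 2; 6; 5]].
  apply/matrixP => -[[|[|[|[|[|//]]]]] ?] [[|[|[|[|[|//]]]]] ?];
    rewrite !mxE !big_ord_recl !big_ord0 !mxE /=; lra.
apply: (@q_mx_le3 _ _ _ 5 1 (-5)); rewrite A2.
apply/matrixP => -[[|[|[|[|[|//]]]]] ?] [[|[|[|[|[|//]]]]] ?];
  rewrite !mxE !big_ord_recl !big_ord0 !mxE /=; lra.
Qed.

Lemma q_Rgraph_le3 n : (3 <= n)%N -> (q R (Rgraph n) <= 3)%N.
Proof.
case: n => [|[|[|[|[|[|n]]]]]] // _; first exact: q_le_order.
- exact: q_Rgraph4_le3.
- exact: q_Rgraph5_le3.
exact: leq_trans (q_Rgraph_le2 _) _.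
Qed.

Lemma q_Rgraph_ge2 n : (2 <= n)%N -> (2 <= q R (Rgraph n))%N.
Proof.
case: n => [|[|m]] // _.
apply: (@q_ge2 _ _ _ (lshift 1 ord0) (rshift m.+1 ord0)).
by rewrite RgraphE -val_eqE /= addn0 ltnn.
Qed.

(** The pairs are the first two path vertices for n = 3, 4 and the middle two
    for n = 5; the last vertex is the apex. *)
Lemma q_Rgraph_ge3 n : (3 <= n <= 5)%N -> (3 <= q R (Rgraph n))%N.
Proof.
case: n => [|[|[|[|[|[|n]]]]]] // _.
- apply: (@q_ge3 _ _ _
    (@Ordinal (2 + 1) 0 isT) (@Ordinal (2 + 1) 1 isT) (@Ordinal (2 + 1) 2 isT)) => //.
    by rewrite (RgraphE (m := 2)).
  by case=> -[|[|[|//]]] ?; rewrite !(RgraphE (m := 2)).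
- apply: (@q_ge3 _ _ _
    (@Ordinal (3 + 1) 0 isT) (@Ordinal (3 + 1) 1 isT) (@Ordinal (3 + 1) 3 isT)) => //.
    by rewrite (RgraphE (m := 3)).
  by case=> -[|[|[|[|//]]]] ?; rewrite !(RgraphE (m := 3)).
apply: (@q_ge3 _ _ _
    (@Ordinal (4 + 1) 1 isT) (@Ordinal (4 + 1) 2 isT) (@Ordinal (4 + 1) 4 isT)) => //.
  by rewrite (RgraphE (m := 4)).
by case=> -[|[|[|[|[|//]]]]] ?; rewrite !(RgraphE (m := 4)).
Qed.

(** The Laplacian of G has 0 as an eigenvalue, so adding a zero row and column
    for the isolated vertex does not enlarge the spectrum. *)
Lemma q_dunion_point m (G : sgraph m) : (0 < m)%N ->
  (q R (dunion G (edgeless 1)) <= m)%N.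
Proof.
move=> m0.
pose L : 'M[R]_m := \matrix_(i, j) ((\sum_k (G i k)%:R) *+ (i == j) - (G i j)%:R).
have Lsym : L^T = L.
  apply/matrixP => i j; rewrite !mxE adj_sym eq_sym.
  by have [->|] := eqVneq i j.
have ev0 : eigenvalue L 0.
  apply/eigenvalueP; exists (const_mx 1).
    rewrite scale0r; apply/rowP => j; rewrite !mxE.
    rewrite -[in LHS]Lsym; under eq_bigr do rewrite !mxE mul1r.
    rewrite big_split /= sumrN; set D := \sum_k (G j k)%:R.
    rewrite (bigD1 j)//= eqxx mulr1n big1 ?addr0 ?subrr// => i ij.
    by rewrite eq_sym (negPf ij).
  apply/eqP => /rowP/(_ (Ordinal m0)); rewrite !mxE => /eqP.
  by rewrite oner_eq0.
apply: (@q_le _ _ _ (block_mx L 0 0 0)).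
  split; first by rewrite tr_block_mx Lsym !trmx0.
  move=> i j ij; rewrite /= /dunion_rel !mxE.
  case: splitP => i' ii'; rewrite !mxE; case: splitP => j' jj'; rewrite !mxE ?eqxx //.
  have /negPf -> : i' != j'.
    by apply: contraNneq ij => E; apply/eqP/val_inj; rewrite /= ii' jj' E.
  by rewrite sub0r oppr_eq0; case: (G i' j'); rewrite ?oner_eq0 ?eqxx.
rewrite -[m in (_ <= m)%N]/(m.+1.-1) -(size_char_poly L); apply: q_mx_le_poly.
  by rewrite monic_neq0 ?char_poly_monic.
move=> a; rewrite -eigenvalue_root_char => /eigenvalueP[v].
rewrite -[v]hsubmxK mul_row_block !mulmx0 !addr0 scale_row_mx => /eq_row_mx[La /eqP].
rewrite eq_sym scaler_eq0 => /orP[/eqP -> //|/eqP ->].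
have [->|v0 _] := eqVneq (lsubmx v) 0; first by rewrite row_mx0 eqxx.
by apply/eigenvalueP; exists (lsubmx v).
Qed.

(** From m = 2 on the bounds 3 and m suffice; below, the orders of the two
    graphs do. *)
Lemma q_add_compl m :
  (q R (Rgraph m.+1) + q R (compl (Rgraph m.+1)) <= m + 1 + 2)%N.
Proof.
rewrite (eq_q _ (@compl_RgraphE m)).
case: m => [|[|m]].
- by apply: leq_trans (leq_add (q_le_order _ _) (q_le_order _ _)) _.
- by apply: leq_trans (leq_add (q_le_order _ _) (q_le_order _ _)) _.
rewrite addnC -addnA leq_add ?q_dunion_point//.
exact: q_Rgraph_le3.
Qed.

End Rn.

Theorem proposition4p2 (R : realType) :
  (forall n : nat, 2 <= n ->
     ((n = 2 \/ 6 <= n) -> q R (Rgraph n) = 2) /\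
     ((3 <= n <= 5) -> q R (Rgraph n) = 3)) /\
  (forall n : nat, 0 < n ->
     forall G : sgraph (n.-1 + 1), G = Rgraph n \/ G = compl (Rgraph n) ->
       q R G + q R (compl G) <= gorder G + 2).
Proof.
split=> [n n2|[//|m] _ G].
  split=> [n26|n35]; apply/eqP; rewrite eqn_leq.
    rewrite q_Rgraph_ge2// andbT.
    by case: n26 => [->|]; [exact: q_le_order|exact: q_Rgraph_le2].
  by rewrite q_Rgraph_ge3// andbT q_Rgraph_le3//; case/andP: n35.
case=> ->; first exact: q_add_compl.
by rewrite (eq_q _ (@compl_complE _ _)) addnC; exact: q_add_compl.
Qed.
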